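(* If $G\in 2^\omega$ is 2-generic (for Cohen forcing), then $G$ is not almost everywhere dominating.
   Context: Cohen forcing is the partial order $2^{<\omega}$, where $\tau$ is an extension of $\sigma$ if $\sigma\sqsubseteq\tau$ ($\sigma$ is an initial segment of $\tau$). A set $G\in 2^\omega$ meets $D\subseteq 2^{<\omega}$ if some initial segment of $G$ is in $D$. $G$ is 2-generic if for each $\Sigma^0_2$ set $D\subseteq 2^{<\omega}$, either $G$ meets $D$ or $G$ meets the set of strings having no extension in $D$. $\mu$ is the fair-coin (Lebesgue) probability measure on $2^\omega$; ''almost all'' means on a set of $\mu$-measure $1$. For $f,g\in\omega^\omega$, $f$ dominates $g$ if $\exists m\,\forall n>m\,(f(n)>g(n))$. A set $A$ is almost everywhere (a.e.) dominating if for almost all $X\in 2^\omega$ and all functions $g\leq_T X$, there is a function $f\leq_T A$ such that $f$ dominates $g$. *)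

(* Defs.v *)
From HB Require Import structures.
From Stdlib Require Cantor.
From mathcomp Require Import all_boot all_order all_algebra.
From mathcomp Require Import lra.
From mathcomp Require Import all_classical all_reals all_analysis.
Set Implicit Arguments.
Unset Strict Implicit.
Unset Printing Implicit Defensive.
Import Order.TTheory GRing.Theory Num.Theory.
Import numFieldNormedType.Exports.

Local Open Scope classical_set_scope.

(* Elements of 2^omega are functions nat -> bool, and a subset of omega is
   identified with its characteristic function; strings are [seq bool]; the
   order "is an initial segment of" on strings is [prefix]. *)

Definition initseg (X : nat -> bool) (n : nat) : seq bool := mkseq X n.

Definition cylinder (s : seq bool) : set (nat -> bool) :=
  [set X | initseg X (size s) = s].

Definition npair (x y : nat) : nat := Cantor.to_nat (x, y).

(* Programs for the partial functions nat -> nat that are recursive relative to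
   an oracle X, i.e. the closure of the initial functions and of X under
   Kleene's schemata; tuples of arguments are coded by iterated [npair]. *)
Inductive prog : Type :=
| Zero | Succ | Fst | Snd | Query
| Pair of prog & prog
| Comp of prog & prog
| PrimRec of prog & prog
| Mu of prog.

Fixpoint primrec_graph (F G : nat -> nat -> Prop) (a n y : nat) : Prop :=
  if n is m.+1 then
    exists2 z, primrec_graph F G a m z & G (npair a (npair m z)) y
  else F a y.

(* [eval X p x y] : program p with oracle X halts on input x with output y. *)
Fixpoint eval (X : nat -> bool) (p : prog) (x y : nat) {struct p} : Prop :=
  match p with
  | Zero => y = 0
  | Succ => y = x.+1
  | Fst => exists b, x = npair y b
  | Snd => exists a, x = npair a y
  | Query => y = X x
  | Pair p1 p2 =>
      exists a b, [/\ eval X p1 x a, eval X p2 x b & y = npair a b]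
  | Comp p1 p2 => exists2 z, eval X p2 x z & eval X p1 z y
  | PrimRec p1 p2 => exists a n,
      x = npair a n /\ primrec_graph (eval X p1) (eval X p2) a n y
  | Mu p1 => eval X p1 (npair x y) 0 /\
      forall k, (k < y)%N -> exists v, eval X p1 (npair x k) v.+1
  end.

Definition turing_le (f : nat -> nat) (X : nat -> bool) : Prop :=
  exists p, forall n, eval X p n (f n).

Definition computable (f : nat -> nat) : Prop := turing_le f (fun=> false).

(* The length-lexicographic bijection between strings and numbers:
   [::] |-> 0, [:: false] |-> 1, [:: true] |-> 2, [:: false; false] |-> 3, ... *)
Definition str_code (s : seq bool) : nat :=
  foldl (fun n (b : bool) => n.*2 + b.+1)%N 0%N s.

Definition computable_rel3 (P : nat -> nat -> seq bool -> bool) : Prop :=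
  exists2 f, computable f &
    forall x y s, f (npair x (npair y (str_code s))) = P x y s.

Definition Sigma02 (D : set (seq bool)) : Prop :=
  exists2 P, computable_rel3 P &
    forall s, D s <-> exists x, forall y, P x y s.

Definition meets (G : nat -> bool) (D : set (seq bool)) : Prop :=
  exists n, D (initseg G n).

Definition no_extension_in (D : set (seq bool)) : set (seq bool) :=
  [set s | forall t, prefix s t -> ~ D t].

Definition two_generic (G : nat -> bool) : Prop :=
  forall D, Sigma02 D -> meets G D \/ meets G (no_extension_in D).

(* 2^omega with its Borel sigma-algebra: every open set is a countable union of
   cylinders. *)
Notation cantor := (g_sigma_algebraType (range cylinder)).

Section fair_coin.
Context {R : realType}.
Local Open Scope ring_scope.

(* The binary expansion of x in [0, 1[ (not ending in 1s) *)
Definition binary_digits (x : measurableTypeR R) : cantor :=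
  fun n => odd (Num.truncn (x * 2 ^+ n.+1)).

Let measurable_truncn_eq (c : R) (k : nat) : 0 < c ->
  measurable [set x : measurableTypeR R | Num.truncn (x * c) = k].
Proof.
move=> c0.
have mgt n : measurable [set x : measurableTypeR R | (n < Num.truncn (x * c))%N].
  rewrite [X in measurable X](_ : _ = [set` `[n.+1%:R / c, +oo[]).
    exact: measurable_itv.
  apply/seteqP; split=> x /=;
    by rewrite in_itv/= andbT truncn_gt_nat ler_pdivrMr.
case: k => [|k].
  rewrite [X in measurable X](_ : _ =
      ~` [set x : measurableTypeR R | (0 < Num.truncn (x * c))%N]).
    exact: measurableC.
  apply/seteqP; split=> x /=; first by move=> ->.
  by move=> /negP; rewrite -eqn0Ngt => /eqP.
rewrite [X in measurable X](_ : _ =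
    [set x : measurableTypeR R | (k < Num.truncn (x * c))%N] `\`
    [set x : measurableTypeR R | (k.+1 < Num.truncn (x * c))%N]).
  exact: measurableD.
apply/seteqP; split=> x /=; first by move=> ->; rewrite ltnn ltnSn.
by case=> h1 /negP; rewrite -leqNgt => h2; apply/eqP; rewrite eqn_leq h2.
Qed.

Lemma cylinder_rcons (s : seq bool) b :
  cylinder (rcons s b) = cylinder s `&` [set X | X (size s) = b].
Proof.
apply/seteqP; split=> X; rewrite /cylinder /initseg /= size_rcons mkseqS.
  by move/rcons_inj => [].
by move=> [-> ->].
Qed.

Lemma cylinder_nil : cylinder [::] = setT.
Proof. by apply/seteqP; split. Qed.

Let measurable_cylinder_preimage s : measurable (binary_digits @^-1` cylinder s).
Proof.
elim/last_ind: s => [|s b IH]; first by rewrite cylinder_nil preimage_setT.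
rewrite cylinder_rcons preimage_setI; apply: measurableI => //.
rewrite [X in measurable X](_ : _ = \bigcup_(k in [set k | odd k = b])
  [set x : measurableTypeR R | Num.truncn (x * 2 ^+ (size s).+1) = k]).
  by apply: bigcup_measurable => k _; apply: measurable_truncn_eq; rewrite exprn_gt0.
apply/seteqP; split=> x /=; last by move=> [k /= <- <-].
by move=> h; exists (Num.truncn (x * 2 ^+ (size s).+1)).
Qed.

Lemma measurable_binary_digits : measurable_fun setT binary_digits.
Proof.
apply: (@measurability _ _ _ cantor setT _ (range cylinder)) => //.
by move=> _ [_ [s _ <-] <-]; rewrite setTI.
Qed.

HB.instance Definition _ :=
  isMeasurableFun.Build _ _ _ _ binary_digits measurable_binary_digits.

End fair_coin.

(* The law of the sequence of binary digits of a uniform point of [0, 1];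
   by [fair_coin_cylinder] it is the fair-coin measure. *)
Definition fair_coin (R : realType) : probability cantor R :=
  distribution (uniform_prob (@ltr01 R)) (@binary_digits R).

Section fair_coin_cylinder.
Context {R : realType}.
Local Open Scope ring_scope.

Let truncn_double (y : R) : 0 <= y -> (Num.truncn (y * 2))./2 = Num.truncn y.
Proof.
move=> y0; apply/esym/truncn_def.
have /andP[] : (Num.truncn (y * 2))%:R <= y * 2 < (Num.truncn (y * 2)).+1%:R.
  by apply: truncn_itv; rewrite mulr_ge0.
move: (Num.truncn (y * 2)) => t; rewrite -(addn1 t) -[in t%:R](odd_double_half t).
rewrite -[in (t + 1)%:R](odd_double_half t) -(addn1 t./2) -!muln2 !natrD !natrM.
by case: (odd t) => /= h1 h2; apply/andP; split; lra.
Qed.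

Let val2 (s : seq bool) : nat := foldl (fun n (b : bool) => b + n.*2)%N 0%N s.

Let val2_rcons s b : val2 (rcons s b) = (b + (val2 s).*2)%N.
Proof. by rewrite /val2 foldl_rcons. Qed.

Let cylinder_truncn (x : R) s : 0 <= x < 1 ->
  cylinder s (binary_digits x) <-> Num.truncn (x * 2 ^+ size s) = val2 s.
Proof.
move=> /andP[x0 x1]; elim/last_ind: s => [|s b IH].
  rewrite cylinder_nil expr0 mulr1; split=> // _.
  by apply: truncn_def; rewrite x0.
rewrite cylinder_rcons val2_rcons size_rcons.
have := @truncn_double (x * 2 ^+ size s); rewrite -mulrA -exprSr mulr_ge0//.
move=> /(_ isT) half; split => [[/IH]|h].
  rewrite -half /= /binary_digits => <- <-.
  by rewrite odd_double_half.
split; first by apply/IH; rewrite -half h; case: b {h}; rewrite /= ?uphalf_double ?doubleK.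
by rewrite /= /binary_digits h oddD odd_double addbF; case: b {h}.
Qed.

Let val2_lt s : (val2 s < 2 ^ size s)%N.
Proof.
elim/last_ind: s => [//|s b IH]; rewrite val2_rcons size_rcons expnS mul2n.
by case: b; rewrite ?add1n ?add0n ?ltn_double// ltn_Sdouble.
Qed.

Lemma fair_coin_cylinder (s : seq bool) :
  fair_coin R (cylinder s) = (2 ^- size s)%:E.
Proof.
pose c : R := 2 ^+ size s; pose v : R := (val2 s)%:R.
have c0 : 0 < c by rewrite exprn_gt0.
have vc : v + 1 <= c by rewrite /v natr1 /c -natrX ler_nat val2_lt.
have v0 : 0 <= v by rewrite ler0n.
pose B : set (measurableTypeR R) := binary_digits @^-1` cylinder s `&` `[0, 1].
have mA : measurable (binary_digits @^-1` cylinder s : set (measurableTypeR R)).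
  rewrite -[X in measurable X]setTI; apply: measurable_binary_digits => //.
  by apply: sub_sigma_algebra; exists s.
have mB : measurable B by apply: measurableI => //; exact: measurable_itv.
transitivity (lebesgue_measure B).
  rewrite /fair_coin /distribution /pushforward /= /uniform_prob.
  rewrite integral_uniform_pdf (eq_integral (cst 1%E)); last first.
    move=> x; rewrite inE => -[_ /=]; rewrite in_itv /= /uniform_pdf => ->.
    by rewrite subr0 invr1.
  by rewrite integral_cst// mul1e.
have m1 : measurable ([set 1] : set (measurableTypeR R)) by exact: measurable_set1.
have -> : lebesgue_measure B =
    (lebesgue_measure (B `\` [set 1%R]) + lebesgue_measure (B `&` [set 1%R]))%E.
  exact: measureDI.
have -> : lebesgue_measure (B `&` [set 1%R]) = 0%E.
  apply: (subset_measure0 (measurableI _ _ mB m1) m1) => //.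
  exact: lebesgue_measure_set1.
rewrite adde0.
have -> : B `\` [set 1] = [set` `[v / c, (v + 1) / c[].
  have itvE x : 0 <= x ->
      (Num.truncn (x * c) = val2 s) <-> (x \in `[v / c, (v + 1) / c[).
    move=> x0; rewrite in_itv/= ler_pdivrMr// ltr_pdivlMr// /v natr1.
    have xc : 0 <= x * c by rewrite mulr_ge0// ltW.
    by rewrite -truncn_eq//; split=> [->|/eqP].
  apply/seteqP; split=> x /=.
    move=> [[Ax /=]]; rewrite in_itv/= => /andP[x0 x1] /eqP xn1.
    apply/itvE => //; apply/cylinder_truncn => //.
    by rewrite x0 lt_neqAle xn1.
  move=> xI; have := xI; rewrite in_itv/= => /andP[vx xv].
  have x0 : 0 <= x by apply: le_trans vx; rewrite divr_ge0// ltW.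
  have x1 : x < 1 by apply: (lt_le_trans xv); rewrite ler_pdivrMr// mul1r.
  split; last by apply/eqP; rewrite lt_eqF.
  split; last by rewrite /= in_itv/= x0 ltW.
  by apply/cylinder_truncn; [rewrite x0|exact/itvE].
rewrite lebesgue_measure_itv/= lte_fin ltr_pM2r ?invr_gt0// ltrDl ltr01.
by rewrite -EFinB -mulrBl addrAC subrr add0r mul1r.
Qed.

End fair_coin_cylinder.

Definition dominates (f g : nat -> nat) : Prop :=
  exists m, forall n, (m < n)%N -> (g n < f n)%N.

Definition ae_dominating (R : realType) (A : nat -> bool) : Prop :=
  {ae fair_coin R, forall X, forall g, turing_le g X ->
     exists2 f, turing_le f A & dominates f g}.

(* Main.v *)
(* Fix a universal oracle machine.  For a request e = (c, t0, m), start from the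
   string t0 and run rounds: round j waits, at an argument n > m allotted to e,
   for an extension of the current string on which the program coded by c halts
   at n, and passes to that extension.  The function g computed from X answers 0
   except that, when round j starts and j is the code of X restricted to e+2, it
   waits for the end of the round and copies the value found.  If e gets stuck,
   only the sequences in one cylinder of measure 2^-(e+2) lose totality, so g is
   total with probability at least 1/2.
   If the program p computes f from a 2-generic G, then genericity for the
   Sigma_2 set of strings forcing p to be partial yields an initial segment of G
   below which rounds always end, and genericity for the Sigma_1 set of strings
   extending the outcome of 2^(e+3) rounds of some e yields an initial segment of
   G along which every X with g total has f n = g n for some n > m. *)

Require Import Defs.
From mathcomp Require Import all_boot all_classical all_reals all_analysis.
From mathcomp Require Import all_order all_algebra zify lra.
From Stdlib Require Cantor.

(** * Pairing and closure properties of relative computability *)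

Definition pi1 (z : nat) : nat := (Cantor.of_nat z).1.
Definition pi2 (z : nat) : nat := (Cantor.of_nat z).2.

Lemma pi1_npair a b : pi1 (npair a b) = a.
Proof. by rewrite /pi1 /npair Cantor.cancel_of_to. Qed.

Lemma pi2_npair a b : pi2 (npair a b) = b.
Proof. by rewrite /pi2 /npair Cantor.cancel_of_to. Qed.

Lemma npair_pi z : npair (pi1 z) (pi2 z) = z.
Proof. by rewrite /npair /pi1 /pi2 -surjective_pairing Cantor.cancel_to_of. Qed.

Lemma leq_npair a b : a + b <= npair a b.
Proof. by have := Cantor.to_nat_non_decreasing a b; rewrite /npair; lia. Qed.

Definition npairE := (pi1_npair, pi2_npair).

Opaque npair pi1 pi2.

Section closure.
Variable X : nat -> bool.
Implicit Types f g h : nat -> nat.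

Lemma turing_le_ext f g : f =1 g -> turing_le f X -> turing_le g X.
Proof. by move=> /funext ->. Qed.

Lemma turing_le_comp f g :
  turing_le f X -> turing_le g X -> turing_le (fun x => f (g x)) X.
Proof. by move=> [p pf] [q qg]; exists (Comp p q) => n; exists (g n). Qed.

Lemma turing_le_succ f : turing_le f X -> turing_le (fun x => (f x).+1) X.
Proof. by apply: (turing_le_comp S); exists Succ. Qed.

Lemma turing_le_query f : turing_le f X -> turing_le (fun x => nat_of_bool (X (f x))) X.
Proof. by apply: (turing_le_comp (fun x => nat_of_bool (X x))); exists Query. Qed.

Lemma turing_le_pi1 f : turing_le f X -> turing_le (fun x => pi1 (f x)) X.
Proof.
by apply: (turing_le_comp pi1); exists Fst => n; exists (pi2 n); rewrite npair_pi.
Qed.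

Lemma turing_le_pi2 f : turing_le f X -> turing_le (fun x => pi2 (f x)) X.
Proof.
by apply: (turing_le_comp pi2); exists Snd => n; exists (pi1 n); rewrite npair_pi.
Qed.

Lemma turing_le_npair f g :
  turing_le f X -> turing_le g X -> turing_le (fun x => npair (f x) (g x)) X.
Proof. by move=> [p pf] [q qg]; exists (Pair p q) => n; exists (f n), (g n). Qed.

Lemma turing_le_id : turing_le (fun x => x) X.
Proof.
apply: (@turing_le_ext (fun x => npair (pi1 x) (pi2 x))) => [x|].
  exact: npair_pi.
exists (Pair Fst Snd) => n; exists (pi1 n), (pi2 n); split => //=.
  by exists (pi2 n); rewrite npair_pi.
by exists (pi1 n); rewrite npair_pi.
Qed.

Lemma turing_le_cst k : turing_le (fun=> k) X.
Proof. by elim: k => [|k IH]; [exists Zero | apply: turing_le_succ]. Qed.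

(** The shape of the first hypothesis is the argument format of [PrimRec]: parameter, stage,
    previous value. *)
Lemma turing_le_iteri (s : nat -> nat -> nat -> nat) f g :
  turing_le (fun z => s (pi1 z) (pi1 (pi2 z)) (pi2 (pi2 z))) X ->
  turing_le f X -> turing_le g X ->
  turing_le (fun x => iteri (f x) (s x) (g x)) X.
Proof.
move=> [p ps] ff gg.
pose F z := iteri (pi2 z) (s (pi1 z)) (g (pi1 z)).
apply: (@turing_le_ext (fun x => F (npair x (f x)))) => [x|].
  by rewrite /F !npairE.
apply: turing_le_comp; last exact: turing_le_npair turing_le_id ff.
have [q qg] := gg.
exists (PrimRec q p) => z /=; exists (pi1 z), (pi2 z); split; first by rewrite npair_pi.
rewrite /F; elim: (pi2 z) => [|n IH]; first exact: qg.
exists (iteri n (s (pi1 z)) (g (pi1 z))) => //=.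
by have := ps (npair (pi1 z) (npair n (iteri n (s (pi1 z)) (g (pi1 z))))); rewrite !npairE.
Qed.

Lemma turing_le_mu (P : nat -> nat -> bool) g :
  turing_le (fun z => nat_of_bool (P (pi1 z) (pi2 z))) X ->
  (forall x, P x (g x)) -> (forall x k, k < g x -> ~~ P x k) -> turing_le g X.
Proof.
move=> PX Pg Pmin.
(* [Mu] looks for a zero, so the truth value is negated: iterating the constant 0 from 1 sends true
   to 0 and false to 1. *)
have [p pP] : turing_le (fun z => iteri (P (pi1 z) (pi2 z)) (fun _ _ => 0) 1) X.
  by apply: (@turing_le_iteri (fun _ _ _ => 0)) => //; apply: turing_le_cst.
exists (Mu p) => x /=; split; first by have := pP (npair x (g x)); rewrite !npairE Pg.
move=> k kg; exists 0; have := pP (npair x k); rewrite !npairE.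
by rewrite (negbTE (Pmin _ _ kg)).
Qed.

Lemma turing_le_add f g :
  turing_le f X -> turing_le g X -> turing_le (fun x => f x + g x) X.
Proof.
move=> ff gg; apply: (@turing_le_ext (fun x => iteri (f x) (fun _ => S) (g x))).
  by move=> x; elim: (f x) => //= n ->.
apply: (@turing_le_iteri (fun _ _ y => y.+1)) => //.
by apply/turing_le_succ/turing_le_pi2/turing_le_pi2/turing_le_id.
Qed.

Lemma turing_le_pred f : turing_le f X -> turing_le (fun x => (f x).-1) X.
Proof.
move=> ff; apply: (@turing_le_ext (fun x => iteri (f x) (fun n _ => n) 0)).
  by move=> x; case: (f x).
apply: (@turing_le_iteri (fun _ n _ => n)) => //; last exact: turing_le_cst.
by apply/turing_le_pi1/turing_le_pi2/turing_le_id.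
Qed.

Lemma turing_le_sub f g :
  turing_le f X -> turing_le g X -> turing_le (fun x => f x - g x) X.
Proof.
move=> ff gg; apply: (@turing_le_ext (fun x => iteri (g x) (fun _ => predn) (f x))).
  by move=> x; elim: (g x) => [|n /= ->] /=; lia.
apply: (@turing_le_iteri (fun _ _ y => y.-1)) => //.
by apply/turing_le_pred/turing_le_pi2/turing_le_pi2/turing_le_id.
Qed.

Lemma turing_le_doublen f : turing_le f X -> turing_le (fun x => (f x).*2) X.
Proof.
move=> ff; apply: (@turing_le_ext (fun x => f x + f x)) => [x|]; first exact: addnn.
exact: turing_le_add.
Qed.

Lemma turing_le_leq f g : turing_le f X -> turing_le g X ->
  turing_le (fun x => nat_of_bool (f x <= g x)) X.
Proof.
move=> ff gg; apply: (@turing_le_ext (fun x => 1 - (f x - g x))) => [x|].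
  by case: leqP; lia.
by apply: turing_le_sub; [apply: turing_le_cst | apply: turing_le_sub].
Qed.

Lemma turing_le_and (b c : nat -> bool) :
  turing_le (fun x => nat_of_bool (b x)) X ->
  turing_le (fun x => nat_of_bool (c x)) X ->
  turing_le (fun x => nat_of_bool (b x && c x)) X.
Proof.
move=> bX cX; apply: (@turing_le_ext (fun x => nat_of_bool (2 <= b x + c x))) => [x|].
  by case: (b x); case: (c x).
by apply: turing_le_leq; [apply: turing_le_cst | apply: turing_le_add].
Qed.

Lemma turing_le_neg (b : nat -> bool) :
  turing_le (fun x => nat_of_bool (b x)) X ->
  turing_le (fun x => nat_of_bool (~~ b x)) X.
Proof.
move=> bX; apply: (@turing_le_ext (fun x => nat_of_bool (b x <= 0))) => [x|].
  by case: (b x).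
by apply: turing_le_leq => //; apply: turing_le_cst.
Qed.

Lemma turing_le_or (b c : nat -> bool) :
  turing_le (fun x => nat_of_bool (b x)) X ->
  turing_le (fun x => nat_of_bool (c x)) X ->
  turing_le (fun x => nat_of_bool (b x || c x)) X.
Proof.
move=> bX cX; apply: (@turing_le_ext (fun x => nat_of_bool (1 <= b x + c x))) => [x|].
  by case: (b x); case: (c x).
by apply: turing_le_leq; [apply: turing_le_cst | apply: turing_le_add].
Qed.

Lemma turing_le_eq f g : turing_le f X -> turing_le g X ->
  turing_le (fun x => nat_of_bool (f x == g x)) X.
Proof.
move=> ff gg; apply: (@turing_le_ext
    (fun x => nat_of_bool ((f x <= g x) && (g x <= f x)))) => [x|].
  by rewrite eqn_leq.
by apply: turing_le_and; apply: turing_le_leq.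
Qed.

Lemma turing_le_if (b : nat -> bool) f g :
  turing_le (fun x => nat_of_bool (b x)) X -> turing_le f X -> turing_le g X ->
  turing_le (fun x => if b x then f x else g x) X.
Proof.
move=> bX ff gg; apply: (@turing_le_ext
    (fun x => iteri (b x) (fun _ _ => f x) (g x))) => [x|]; first by case: (b x).
apply: (@turing_le_iteri (fun x _ _ => f x)) => //.
by apply: (turing_le_comp f) => //; apply/turing_le_pi1/turing_le_id.
Qed.

Lemma turing_le_half f : turing_le f X -> turing_le (fun x => (f x)./2) X.
Proof.
move=> ff; apply: (turing_le_comp half) => //.
(* Half of x is the least k with x <= 2k+1. *)
apply: (@turing_le_mu (fun x k => x <= k.*2.+1)).
- apply: turing_le_leq; first exact/turing_le_pi1/turing_le_id.
  exact/turing_le_succ/turing_le_doublen/turing_le_pi2/turing_le_id.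
- by move=> x; lia.
- by move=> x k; lia.
Qed.

Lemma turing_le_odd f : turing_le f X -> turing_le (fun x => nat_of_bool (odd (f x))) X.
Proof.
move=> ff; apply: (@turing_le_ext (fun x => f x - (f x)./2.*2)) => [x|].
  by have := odd_double_half (f x); lia.
by apply: turing_le_sub => //; apply/turing_le_doublen/turing_le_half.
Qed.

Lemma turing_le_exp2 f : turing_le f X -> turing_le (fun x => 2 ^ f x) X.
Proof.
move=> ff; apply: (@turing_le_ext (fun x => iteri (f x) (fun _ y => y.*2) 1)) => [x|].
  by elim: (f x) => //= n ->; rewrite expnS mul2n.
apply: (@turing_le_iteri (fun _ _ y => y.*2)) => //; last exact: turing_le_cst.
exact/turing_le_doublen/turing_le_pi2/turing_le_pi2/turing_le_id.
Qed.

Lemma turing_le_comp2 (F : nat -> nat -> nat) f g :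
  turing_le (fun z => F (pi1 z) (pi2 z)) X ->
  turing_le f X -> turing_le g X -> turing_le (fun x => F (f x) (g x)) X.
Proof.
move=> FX ff gg; apply: (@turing_le_ext
    (fun x => F (pi1 (npair (f x) (g x))) (pi2 (npair (f x) (g x))))) => [x|].
  by rewrite !npairE.
by apply: (turing_le_comp (fun z => F (pi1 z) (pi2 z))) => //; apply: turing_le_npair.
Qed.

Lemma turing_le_comp3 (F : nat -> nat -> nat -> nat) f g h :
  turing_le (fun z => F (pi1 z) (pi1 (pi2 z)) (pi2 (pi2 z))) X ->
  turing_le f X -> turing_le g X -> turing_le h X ->
  turing_le (fun x => F (f x) (g x) (h x)) X.
Proof.
move=> FX ff gg hh; apply: (@turing_le_ext (fun x => let z := npair (g x) (h x) in
    F (f x) (pi1 z) (pi2 z))) => [x|]; first by rewrite /= !npairE.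
by apply: (@turing_le_comp2 (fun a b => F a (pi1 b) (pi2 b))) => //; apply: turing_le_npair.
Qed.

End closure.

(** Descends through the syntax of the function body; subterms of any other shape are left as
    goals. *)
Ltac tle_step :=
  lazymatch goal with
  | |- turing_le (fun=> ?c) _ => exact: (turing_le_cst _ c)
  | |- turing_le (fun x => x) _ => exact: turing_le_id
  | |- turing_le pi1 _ => exact: (turing_le_pi1 _ _ (turing_le_id _))
  | |- turing_le pi2 _ => exact: (turing_le_pi2 _ _ (turing_le_id _))
  | |- turing_le (fun x => (@?f x).+1) _ => apply: (turing_le_succ _ f)
  | |- turing_le (fun x => (@?f x).-1) _ => apply: (turing_le_pred _ f)
  | |- turing_le (fun x => pi1 (@?f x)) _ => apply: (turing_le_pi1 _ f)
  | |- turing_le (fun x => pi2 (@?f x)) _ => apply: (turing_le_pi2 _ f)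
  | |- turing_le (fun x => npair (@?f x) (@?g x)) _ => apply: (turing_le_npair _ f g)
  | |- turing_le (fun x => (@?f x) + (@?g x)) _ => apply: (turing_le_add _ f g)
  | |- turing_le (fun x => (@?f x) - (@?g x)) _ => apply: (turing_le_sub _ f g)
  | |- turing_le (fun x => (@?f x)./2) _ => apply: (turing_le_half _ f)
  | |- turing_le (fun x => (@?f x).*2) _ => apply: (turing_le_doublen _ f)
  | |- turing_le (fun x => 2 ^ (@?f x)) _ => apply: (turing_le_exp2 _ f)
  | |- turing_le (fun x => nat_of_bool (odd (@?f x))) _ => apply: (turing_le_odd _ f)
  | |- turing_le (fun x => nat_of_bool ((@?f x) == (@?g x))) _ => apply: (turing_le_eq _ f g)
  | |- turing_le (fun x => nat_of_bool ((@?f x) <= (@?g x))) _ => apply: (turing_le_leq _ f g)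
  | |- turing_le (fun x => nat_of_bool (~~ (@?f x))) _ => apply: (turing_le_neg _ f)
  | |- turing_le (fun x => nat_of_bool ((@?f x) && (@?g x))) _ => apply: (turing_le_and _ f g)
  | |- turing_le (fun x => nat_of_bool ((@?f x) || (@?g x))) _ => apply: (turing_le_or _ f g)
  | |- turing_le (fun x => if _ then _ else _) _ => apply: turing_le_if
  end.
Ltac tle := repeat tle_step.

(** * Computing with strings through their codes *)

(** The inverse of [str_code]. Halving is not a structural recursive call, and fuel c suffices
    because each call lowers the code. *)
Fixpoint dec_fuel k c : seq bool :=
  if k is k'.+1 then
    if c is c'.+1 then rcons (dec_fuel k' c'./2) (odd c') else [::]
  else [::].
Definition dec c := dec_fuel c c.

Lemma str_code_rcons s b : str_code (rcons s b) = (str_code s).*2 + b.+1.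
Proof. by rewrite /str_code foldl_rcons. Qed.

Lemma decK c : str_code (dec c) = c.
Proof.
rewrite /dec; suff H k : forall c, c <= k -> str_code (dec_fuel k c) = c by apply: H.
elim: k => [|k IH] [|d] //= dk; rewrite str_code_rcons IH; last by lia.
by have := odd_double_half d; lia.
Qed.

Lemma str_code_inj : injective str_code.
Proof.
elim/last_ind => [|s b IH] t; case/lastP: t => [|t d] //; rewrite ?str_code_rcons //=.
- by rewrite /str_code /=; lia.
- by rewrite {2}/str_code /=; lia.
by case: b d => [] [] /= e; rewrite (IH t) //; lia.
Qed.

Lemma str_codeK s : dec (str_code s) = s.
Proof. by apply: str_code_inj; rewrite decK. Qed.

Lemma size_le_str_code s : size s <= str_code s.
Proof.
by elim/last_ind: s => // s b IH; rewrite size_rcons str_code_rcons; lia.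
Qed.

Lemma str_code_lt s : (str_code s).+1 < 2 ^ (size s).+1.
Proof.
elim/last_ind: s => // s b IH; rewrite size_rcons str_code_rcons expnS.
by move: IH; case: b; move: (2 ^ _) => k; lia.
Qed.

(** Deletes the last bit of a string, on codes; the empty string, coded by 0, is fixed. *)
Definition cut c := c.-1./2.

Lemma cut_rcons s b : cut (str_code (rcons s b)) = str_code s.
Proof. by rewrite str_code_rcons /cut; case: b => /=; lia. Qed.

Lemma iter_cut k s : iter k cut (str_code s) = str_code (take (size s - k) s).
Proof.
elim: k => [|k IH]; first by rewrite subn0 take_size.
rewrite iterS IH; case: (ltnP k (size s)) => ks; last first.
  have -> : size s - k = 0 by lia.
  have -> : size s - k.+1 = 0 by lia.
  by rewrite take0.
have -> : size s - k = (size s - k.+1).+1 by lia.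
by rewrite (take_nth false) ?cut_rcons //; lia.
Qed.

Section string_ops.
Variable X : nat -> bool.
Implicit Types f g h : nat -> nat.

Lemma turing_le_iter_cut f g : turing_le f X -> turing_le g X ->
  turing_le (fun x => iter (f x) cut (g x)) X.
Proof.
move=> ff gg; apply: (@turing_le_ext _ (fun x => iteri (f x) (fun _ => cut) (g x))) => [x|].
  by elim: (f x) => //= n ->.
by apply: (@turing_le_iteri _ (fun _ _ => cut)) => //; rewrite /cut; tle.
Qed.

Lemma turing_le_size f : turing_le f X -> turing_le (fun x => size (dec (f x))) X.
Proof.
apply: (turing_le_comp _ (fun c => size (dec c))).
apply: (@turing_le_mu _ (fun c k => iter k cut c == 0)).
- by tle; apply: turing_le_iter_cut; tle.
- by move=> c; rewrite -[X in iter _ cut X]decK iter_cut subnn take0.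
move=> c k kc; rewrite -[X in iter _ cut X]decK iter_cut; apply/eqP => e0.
have := size_le_str_code (take (size (dec c) - k) (dec c)).
by rewrite e0 size_take; case: ifP; lia.
Qed.

(* 0 marks a position outside the string; the bit b is reported as b.+1. *)
Definition query (s : seq bool) (n : nat) : nat := nth 0 [seq (nat_of_bool b).+1 | b <- s] n.

(** A nonempty string has an odd code exactly when its last bit is [false], so cutting down to
    length n+1 exposes bit n. *)
Lemma query_dec c n : query (dec c) n =
  if n.+1 <= size (dec c) then
    if odd (iter (size (dec c) - n.+1) cut c) then 1 else 2
  else 0.
Proof.
rewrite -[X in iter _ cut X]decK iter_cut /query; set s := dec c.
case: ltnP => [ns|sn]; last by rewrite nth_default // size_map.
rewrite (nth_map false) // subKn // (take_nth false) // str_code_rcons.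
by rewrite oddD odd_double; case: nth.
Qed.

Lemma turing_le_query_dec f g : turing_le f X -> turing_le g X ->
  turing_le (fun x => query (dec (f x)) (g x)) X.
Proof.
move=> ff gg; apply: turing_le_ext => [x|]; first by rewrite query_dec.
have szf := turing_le_size f ff.
by tle => //; apply: turing_le_iter_cut => //; tle.
Qed.

Lemma prefix_dec a b :
  prefix (dec a) (dec b) = (iter (size (dec b) - size (dec a)) cut b == a).
Proof.
rewrite -[X in iter _ cut X]decK iter_cut; apply/idP/eqP => [|e].
  rewrite prefixE => /eqP e; rewrite subKn ?e ?decK //.
  by rewrite -e size_take; case: ifP; lia.
rewrite -[X in prefix _ X](cat_take_drop (size (dec b) - (size (dec b) - size (dec a)))).
by rewrite -{1}e str_codeK prefix_prefix.
Qed.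

Lemma turing_le_prefix f g : turing_le f X -> turing_le g X ->
  turing_le (fun x => nat_of_bool (prefix (dec (f x)) (dec (g x)))) X.
Proof.
move=> ff gg; apply: turing_le_ext => [x|]; first by rewrite prefix_dec.
have szf := turing_le_size f ff; have szg := turing_le_size g gg.
by tle => //; apply: turing_le_iter_cut => //; tle.
Qed.

End string_ops.

Lemma query_prefix s t n : prefix s t -> query s n = 0 \/ query t n = query s n.
Proof.
case/prefixP => u ->; rewrite /query map_cat nth_cat size_map.
by case: ltnP => sn; [right | left; rewrite nth_default ?size_map].
Qed.

Lemma initseg_prefix X l k : l <= k -> prefix (initseg X l) (initseg X k).
Proof.
by move=> lk; rewrite prefixE size_mkseq /initseg /mkseq -map_take take_iota (minn_idPl lk).
Qed.

Lemma query_initseg X l n : n < l -> query (initseg X l) n = (X n).+1.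
Proof. by move=> nl; rewrite /query (nth_map false) ?size_mkseq ?nth_mkseq. Qed.

(** * A universal oracle machine *)

Fixpoint code (p : prog) : nat :=
  match p with
  | Zero => npair 0 0
  | Succ => npair 1 0
  | Fst => npair 2 0
  | Snd => npair 3 0
  | Query => npair 4 0
  | Pair p q => npair 5 (npair (code p) (code q))
  | Comp p q => npair 6 (npair (code p) (code q))
  | PrimRec p q => npair 7 (npair (code p) (code q))
  | Mu p => npair 8 (code p)
  end.

Definition push (c K : nat) : nat := (npair c K).+1.

(* A state is npair K v: a stack K of instructions (0 when empty) and the
   current value v, to which the top instruction applies.  Tags 9 and 10 hold
   the pending second component of a pair and its computed first component;
   tag 11 is a primitive recursion at stage m out of n, and tag 12 a search that
   has reached candidate k. *)
Definition step (q : nat -> nat) (st : nat) : nat :=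
  let v := pi2 st in
  let K := pi2 (pi1 st).-1 in
  let t := pi1 (pi1 (pi1 st).-1) in
  let d := pi2 (pi1 (pi1 st).-1) in
  let d1 := pi1 d in
  let d2 := pi2 d in
  if pi1 st == 0 then st else
  if t == 0 then npair K 0 else
  if t == 1 then npair K v.+1 else
  if t == 2 then npair K (pi1 v) else
  if t == 3 then npair K (pi2 v) else
  if t == 4 then (if q v == 0 then st else npair K (q v).-1) else
  if t == 5 then npair (push d1 (push (npair 9 (npair d2 v)) K)) v else
  if t == 6 then npair (push d2 (push d1 K)) v else
  if t == 7 then
    npair (push d1 (push (npair 11 (npair d2 (npair v 0))) K)) (pi1 v) else
  if t == 8 then npair (push d (push (npair 12 (npair d (npair v 0))) K)) (npair v 0) else
  if t == 9 then npair (push d1 (push (npair 10 v) K)) d2 else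
  if t == 10 then npair K (npair d v) else
  let x := pi1 d2 in
  let m := pi2 d2 in
  if t == 11 then
    if m == pi2 x then npair K v else
    npair (push d1 (push (npair 11 (npair d1 (npair x m.+1))) K))
          (npair (pi1 x) (npair m v))
  else
    if v == 0 then npair K m else
    npair (push d1 (push (npair 12 (npair d1 (npair x m.+1))) K)) (npair x m.+1).

(** The string is both the oracle and the clock, which makes halting decidable. A query outside the
    string stalls, so no answer is ever guessed. *)
Definition run (s : seq bool) (c x : nat) : nat :=
  iter (size s) (step (query s)) (npair (push c 0) x).
Definition halts s c x : bool := pi1 (run s c x) == 0.
Definition output s c x : nat := pi2 (run s c x).

Lemma turing_le_run X f g h : turing_le f X -> turing_le g X -> turing_le h X ->
  turing_le (fun x => run (dec (f x)) (g x) (h x)) X.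
Proof.
move=> ff gg hh; apply: (@turing_le_comp3 _ (fun a c x => run (dec a) c x)) => //.
apply: (@turing_le_ext _ (fun z => iteri (size (dec (pi1 z)))
  (fun _ => step (query (dec (pi1 z)))) (npair (push (pi1 (pi2 z)) 0) (pi2 (pi2 z))))) => [z|].
  by rewrite /run; elim: (size _) => //= n ->.
apply: (@turing_le_iteri _ (fun z _ => step (query (dec (pi1 z))))).
- have qX : turing_le (fun z => query (dec (pi1 (pi1 z))) (pi2 (pi2 (pi2 z)))) X.
    by apply: turing_le_query_dec; tle.
  by rewrite /step /push; cbv zeta; tle.
- by apply: turing_le_size; tle.
- by rewrite /push; tle.
Qed.

Lemma step0 q v : step q (npair 0 v) = npair 0 v.
Proof. by rewrite /step !npairE. Qed.

Lemma iter_step0 q k st : pi1 st = 0 -> iter k (step q) st = st.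
Proof. by move=> h; elim: k => //= k ->; rewrite -(npair_pi st) h step0. Qed.

(** The two oracles can differ only where the shorter one is silent, and there a query leaves the
    state unchanged. *)
Lemma step_prefix s t st : prefix s t ->
  step (query t) st = step (query s) st \/ step (query s) st = st.
Proof.
move=> st_; case: (query_prefix s t (pi2 st) st_) => [q0|qE]; last first.
  by left; rewrite /step qE.
have [p0|p0] := eqVneq (pi1 st) 0; first by left; rewrite /step p0.
have [t4|t4] := eqVneq (pi1 (pi1 (pi1 st).-1)) 4.
  by right; rewrite /step t4 (negbTE p0) q0.
by left; rewrite /step; cbv zeta; rewrite (negbTE t4).
Qed.

(** If f fixes a state, its run stays there for ever; when that run halts, the state is already
    halted and g fixes it too. Elsewhere f and g agree. *)
Lemma iter_halted (f g : nat -> nat) k st :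
  (forall a, g a = f a \/ f a = a) -> (forall a, pi1 a = 0 -> g a = a) ->
  pi1 (iter k f st) = 0 -> iter k g st = iter k f st.
Proof.
move=> gf g0; elim: k st => // k IH st; rewrite !iterSr.
have [->|fst] := gf st; first exact: IH.
have itf n : iter n f st = st by elim: n => //= n ->.
have itg n : pi1 st = 0 -> iter n g st = st.
  by move=> st0; elim: n => //= n ->; exact: g0.
by rewrite fst itf => st0; rewrite g0 // itg.
Qed.

Lemma run_prefix s t c x : prefix s t -> halts s c x -> run t c x = run s c x.
Proof.
move=> st_; rewrite /halts /run; move: (npair _ _) => st /eqP h.
have -> : size t = (size t - size s) + size s.
  by rewrite subnK //; case/prefixP: st_ => u ->; rewrite size_cat leq_addr.
rewrite iterD.
have -> : iter (size s) (step (query t)) st = iter (size s) (step (query s)) st.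
  apply: iter_halted => // a; first exact: step_prefix.
  by move=> a0; exact: (iter_step0 _ 1).
exact: iter_step0.
Qed.

Section completeness.
Variable X : nat -> bool.

(** The step count k is independent of l, so a segment of length at least both k and L also allows
    enough steps. *)
Definition reach (st st' : nat) : Prop := exists k L, forall l, L <= l ->
  iter k (step (query (initseg X l))) st = st'.

Lemma reach_refl st : reach st st.
Proof. by exists 0, 0. Qed.

Lemma reach_trans a b c : reach a b -> reach b c -> reach a c.
Proof.
move=> [k [L h]] [k' [L' h']]; exists (k' + k), (maxn L L') => l.
by rewrite geq_max => /andP[l1 l2]; rewrite iterD h // h'.
Qed.

Lemma reach_step a b c :
  (forall q, step q a = b) -> reach b c -> reach a c.
Proof.
by move=> h; apply: reach_trans; exists 1, 0 => l _ /=.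
Qed.

(** Induction on the program. The stack K is arbitrary so that the hypotheses apply to subprograms
    run above pending instructions. *)
Lemma reach_eval p x y K :
  Defs.eval X p x y -> reach (npair (push (code p) K) x) (npair K y).
Proof.
have last a b : (forall q, step q a = b) -> reach a b.
  by move=> h; apply: reach_step (reach_refl b).
elim: p x y K => [||||| p IHp q IHq | p IHp q IHq | p IHp q IHq | p IHp] x y K /=.
- by move=> ->; apply: last => q; rewrite /step /push !npairE /= ?npairE.
- by move=> ->; apply: last => q; rewrite /step /push !npairE /= ?npairE.
- by move=> [b ->]; apply: last => q; rewrite /step /push !npairE /= ?npairE.
- by move=> [b ->]; apply: last => q; rewrite /step /push !npairE /= ?npairE.
(* The segment must contain position x for the query to be answered. *)
- move=> ->; exists 1, x.+1 => l xl.
  by rewrite /= /step /push !npairE /= ?npairE query_initseg.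
- move=> [a [b [pa qb ->]]].
  apply: reach_step => [r|]; first by rewrite /step /push !npairE /= ?npairE.
  apply: reach_trans; first exact: IHp pa.
  apply: reach_step => [r|]; first by rewrite /step /push !npairE /= ?npairE.
  apply: reach_trans; first exact: IHq qb.
  by apply: last => r; rewrite /step /push !npairE /= ?npairE.
- move=> [z qz pz].
  apply: reach_step => [r|]; first by rewrite /step /push !npairE /= ?npairE.
  by apply: reach_trans; [exact: IHq qz | exact: IHp pz].
- move=> [a [n [-> ]]] gr.
  apply: reach_step => [r|]; first by rewrite /step /push !npairE /= ?npairE.
  have stage m z : m <= n -> primrec_graph (Defs.eval X p) (Defs.eval X q) a m z ->
      reach (npair (push (code p)
               (push (npair 11 (npair (code q) (npair (npair a n) 0))) K)) a)
            (npair (push (npair 11 (npair (code q) (npair (npair a n) m))) K) z).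
    elim: m z => [|m IH] z mn /=; first exact: IHp.
    move=> [w /IH mw qz]; apply: reach_trans; first by apply: mw; lia.
    apply: reach_step => [r|]; last exact: IHq qz.
    rewrite /step /push !npairE /= ?npairE; case: eqP => [?|//]; lia.
  apply: reach_trans; first exact: stage gr.
  by apply: last => r; rewrite /step /push !npairE /= ?npairE eqxx.
- move=> [py lty].
  apply: reach_step => [r|]; first by rewrite /step /push !npairE /= ?npairE.
  have search k : k <= y ->
      reach (npair (push (code p)
               (push (npair 12 (npair (code p) (npair x 0))) K)) (npair x 0))
            (npair (push (code p)
               (push (npair 12 (npair (code p) (npair x k))) K)) (npair x k)).
    elim: k => [_|k IH ky]; first exact: reach_refl.
    apply: reach_trans; first by apply: IH; lia.
    have [v pv] := lty k ky.
    apply: reach_trans; first exact: IHp pv.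
    by apply: last => r; rewrite /step /push !npairE /= ?npairE.
  apply: reach_trans; first exact: (search y (leqnn y)).
  apply: reach_trans; first exact: IHp py.
  by apply: last => r; rewrite /step /push !npairE /= ?npairE.
Qed.

Lemma run_complete p x y : Defs.eval X p x y ->
  exists L, forall l, L <= l ->
    halts (initseg X l) (code p) x /\ output (initseg X l) (code p) x = y.
Proof.
move=> /(reach_eval p x y 0)[k [L h]]; exists (maxn k L) => l.
rewrite geq_max => /andP[kl Ll].
suff E : run (initseg X l) (code p) x = npair 0 y by rewrite /halts /output E !npairE.
rewrite /run size_mkseq -(subnK kl) iterD subnK // h //.
by rewrite iter_step0 ?npairE.
Qed.

(** The true value appears on some longer segment, and extending the oracle preserves the result of
    a halted run. *)
Lemma run_sound p x y l : Defs.eval X p x y ->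
  halts (initseg X l) (code p) x -> output (initseg X l) (code p) x = y.
Proof.
move=> /run_complete[L h] hl; have [_ <-] := h (maxn L l) (leq_maxl _ _).
by rewrite /output (run_prefix _ _ _ _ _ hl) ?initseg_prefix ?leq_maxr.
Qed.

End completeness.

(** * The rounds of a request *)

(* A state is the number of completed rounds, the starting time of the current
   round and the code of the string reached.  Only the string with code k is
   tested at time k; nothing is missed, because halting is inherited by
   extensions, which have arbitrarily large codes. *)
Definition stage (e k st : nat) : nat :=
  if prefix (dec (pi2 (pi2 st))) (dec k) && halts (dec k) (pi1 e) (npair e (pi1 (pi2 st)))
  then npair (pi1 st).+1 (npair k.+1 k) else st.

(** The layout of e is that of [request] below, so [pi1 (pi2 e)] codes the starting string. *)
Definition proc (e t : nat) : nat :=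
  iteri t (stage e) (npair 0 (npair 0 (pi1 (pi2 e)))).

Definition idx e t := pi1 (proc e t).
Definition start e t := pi1 (pi2 (proc e t)).
Definition tip e t := dec (pi2 (pi2 (proc e t))).

Lemma turing_le_proc X f g : turing_le f X -> turing_le g X ->
  turing_le (fun x => proc (f x) (g x)) X.
Proof.
move=> ff gg; apply: (@turing_le_comp2 _ proc) => //; rewrite /proc.
apply: (@turing_le_iteri _ (fun z k st => stage (pi1 z) k st)); [|by tle|by tle].
rewrite /stage /halts; tle; last by apply: turing_le_run; tle.
by apply: turing_le_prefix; tle.
Qed.

Lemma turing_le_idx X f g : turing_le f X -> turing_le g X ->
  turing_le (fun x => idx (f x) (g x)) X.
Proof. by move=> ff gg; rewrite /idx; tle; apply: turing_le_proc. Qed.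

Section process.
Variable e : nat.

Lemma procS t :
  (prefix (tip e t) (dec t) && halts (dec t) (pi1 e) (npair e (start e t)) /\
   proc e t.+1 = npair (idx e t).+1 (npair t.+1 t)) \/
  (~~ (prefix (tip e t) (dec t) && halts (dec t) (pi1 e) (npair e (start e t))) /\
   proc e t.+1 = proc e t).
Proof.
have -> : proc e t.+1 = stage e t (proc e t) by [].
by rewrite /stage -/(idx e t) -/(start e t) -/(tip e t); case: ifP; [left|right].
Qed.

Lemma idx_mono t u : t <= u -> idx e t <= idx e u.
Proof.
move=> /subnKC <-; elim: (u - t) => [|k IH]; first by rewrite addn0.
rewrite addnS; apply: (leq_trans IH).
by case: (procS (t + k)) => [[_]|[_]]; rewrite /idx => ->; rewrite ?npairE.
Qed.

(** Every change of state increments the number of completed rounds. *)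
Lemma proc_idx t u : t <= u -> idx e u = idx e t -> proc e u = proc e t.
Proof.
move=> /subnKC <-; elim: (u - t) => [|k IH]; first by rewrite addn0.
rewrite addnS => h.
have ik : idx e (t + k) = idx e t.
  by have := idx_mono _ _ (leq_addr k t); have := idx_mono _ _ (leqnSn (t + k)); lia.
case: (procS (t + k)) => [[_ E]|[_ ->]]; last exact: IH.
by move: h; rewrite /idx E npairE -/(idx e (t + k)) ik => /eqP; rewrite eqn_leq ltnn.
Qed.

Lemma tip_prefix t : prefix (tip e 0) (tip e t).
Proof.
elim: t => [|t IH]; first exact: prefix_refl.
case: (procS t) => [[/andP[p _] E]|[_ E]].
  by rewrite {2}/tip E !npairE; exact: prefix_trans p.
by rewrite {2}/tip E -/(tip e t).
Qed.

(** The history of the process: u and v are the times at which round j starts and ends. The middle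
    clause, that nothing has changed since the current round started, supplies u when that round
    ends. *)
Lemma proc_rounds t :
  [/\ start e t <= t, proc e (start e t) = proc e t &
   forall j, j < idx e t -> exists u v,
     [/\ [/\ idx e u = j, start e u = u & idx e v = j],
         idx e v.+1 = j.+1, halts (dec v) (pi1 e) (npair e u) &
         prefix (dec v) (tip e t)]].
Proof.
elim: t => [|t [st_t proc_st rounds]].
  by rewrite /start /idx /= !npairE.
case: (procS t) => [[/andP[pt ht] E]|[_ E]]; last first.
  rewrite /start /idx /tip E; split => //; exact: leqW.
have idxS : idx e t.+1 = (idx e t).+1 by rewrite /idx E npairE.
have startS : start e t.+1 = t.+1 by rewrite /start E !npairE.
have tipS : tip e t.+1 = dec t by rewrite /tip E !npairE.
split; rewrite ?startS // => j; rewrite idxS ltnS leq_eqVlt => /orP[/eqP ->|].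
  exists (start e t), t; rewrite tipS prefix_refl; split => //; split => //.
    by rewrite /idx proc_st.
  by rewrite {1}/start proc_st.
move=> /rounds[u [v [h hS hv pv]]]; exists u, v; split => //.
by rewrite tipS; exact: prefix_trans pt.
Qed.

Lemma proc_unbounded :
  (forall t u, exists2 rho, prefix (tip e t) rho & halts rho (pi1 e) (npair e u)) ->
  forall j, exists t, j <= idx e t.
Proof.
move=> ext; elim=> [|j [t jt]]; first by exists 0.
have [rho p_rho h_rho] := ext t (start e t).
(* Padding by t bits makes the code at least t, so this string is still to be tested at time t. *)
pose v := str_code (rho ++ nseq t false).
have tv : t <= v.
  by apply: leq_trans (size_le_str_code _); rewrite size_cat size_nseq leq_addl.
exists v.+1; apply: leq_ltn_trans jt _.
have := idx_mono _ _ tv; rewrite leq_eqVlt => /orP[/eqP iv|iv]; last first.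
  exact: leq_trans iv (idx_mono _ _ (leqnSn v)).
have Ev := proc_idx _ _ tv (esym iv).
case: (procS v) => [[_ E]|[]]; first by rewrite {2}/idx E npairE iv.
rewrite /tip /start Ev -/(tip e t) -/(start e t) str_codeK.
have p_ext : prefix rho (rho ++ nseq t false) by exact: prefix_prefix.
rewrite /halts (run_prefix _ _ _ _ p_ext h_rho) -/(halts rho _ _) h_rho andbT.
by rewrite (prefix_trans p_rho p_ext).
Qed.

End process.

(** * The function computed from X *)

(** An argument n codes a request and a time; it matters only if a round starts at that time and has
    the index selected by X. *)
Definition waits (X : nat -> bool) (n : nat) : bool :=
  (start (pi1 n) (pi2 n) == pi2 n) &&
  (str_code (initseg X (pi1 n).+2) == idx (pi1 n) (pi2 n)).

(** With [v.+1] instead of [v], the least v for a waiting n is the code of the string that ends the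
    round. *)
Definition served X n v : bool :=
  ~~ waits X n || (idx (pi1 n) (pi2 n) < idx (pi1 n) v.+1).

(** The function g of the overview; H is the totality of its search on X. *)
Definition escape X (H : forall n, exists v, served X n v) (n : nat) : nat :=
  if waits X n then output (dec (ex_minn (H n))) (pi1 (pi1 n)) n else 0.

Lemma turing_le_initseg X f : turing_le f X ->
  turing_le (fun x => str_code (initseg X (f x))) X.
Proof.
move=> ff; apply: (@turing_le_ext _
    (fun x => iteri (f x) (fun n c => c.*2 + (X n).+1) 0)) => [x|].
  by elim: (f x) => //= n ->; rewrite /initseg mkseqS str_code_rcons.
apply: (@turing_le_iteri _ (fun _ n c => c.*2 + (X n).+1)) => //; last by tle.
by tle; apply: turing_le_query; tle.
Qed.

Lemma turing_le_waits X f : turing_le f X ->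
  turing_le (fun x => nat_of_bool (waits X (f x))) X.
Proof.
move=> ff; apply: (@turing_le_comp _ (fun n => nat_of_bool (waits X n))) => //.
rewrite /waits /start; tle.
- by apply: turing_le_proc; tle.
- by apply: turing_le_initseg; tle.
- by apply: turing_le_idx; tle.
Qed.

Lemma turing_le_escape X H : turing_le (escape X H) X.
Proof.
have minX : turing_le (fun n => ex_minn (H n)) X.
  apply: (@turing_le_mu _ (served X)).
  - rewrite /served; tle; [apply: turing_le_waits; tle|..].
      by apply: turing_le_idx; tle.
    by apply: turing_le_idx; tle.
  - by move=> x; case: ex_minnP.
  move=> x k; case: ex_minnP => m _ mmin km; apply/negP => /mmin; lia.
rewrite /escape /output; tle; first by apply: turing_le_waits; tle.
by apply: turing_le_run => //; tle.
Qed.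

(** By monotonicity of [idx], a stop before v would contradict [idx e v = idx e u], so the search
    stops exactly at v. *)
Lemma escape_round X H e u v : waits X (npair e u) ->
  idx e v = idx e u -> idx e v.+1 = (idx e u).+1 ->
  escape X H (npair e u) = output (dec v) (pi1 e) (npair e u).
Proof.
move=> wX iv ivS; rewrite /escape wX npairE; congr (output (dec _)).
case: ex_minnP => m; rewrite /served wX !npairE /= => mu mmin.
apply/eqP; rewrite eqn_leq mmin /= ?wX ?npairE ?ivS //.
case: leqP => // mv; move: mu; have := idx_mono e _ _ mv; lia.
Qed.

(** A request gets stuck at only one index, its maximal one, and by injectivity of [str_code] this
    determines the first e+2 bits of X. *)
Lemma stuck_string e : exists s, size s = e.+2 /\ forall X u,
  (forall t, idx e t <= idx e u) -> str_code (initseg X e.+2) = idx e u ->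
  cylinder s X.
Proof.
have [[[X u] [maxu Xu]]|none] := pselect (exists Xu : (nat -> bool) * nat,
    (forall t, idx e t <= idx e Xu.2) /\ str_code (initseg Xu.1 e.+2) = idx e Xu.2).
  have szX : size (initseg X e.+2) = e.+2 by rewrite size_mkseq.
  exists (initseg X e.+2); split => // Y w maxw Yw.
  rewrite /cylinder /mkset szX; apply: str_code_inj.
  by rewrite Yw Xu; apply/eqP; rewrite eqn_leq maxw maxu.
(* If no sequence is affected, any string of the right length serves. *)
exists (nseq e.+2 false); split; first by rewrite size_nseq.
by move=> X u maxu Xu; case: none; exists (X, u).
Qed.

Lemma not_stuck_served X :
  (forall e u, (forall t, idx e t <= idx e u) -> str_code (initseg X e.+2) != idx e u) ->
  forall n, exists v, served X n v.
Proof.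
move=> ns n; rewrite /served; case wX: (waits X n) => /=; last by exists 0.
case/andP: wX => _ /eqP wX.
have [[t it]|none] := pselect (exists t, idx (pi1 n) (pi2 n) < idx (pi1 n) t).
  exists t; exact: leq_trans it (idx_mono _ _ _ (leqnSn t)).
suff maxn : forall t, idx (pi1 n) t <= idx (pi1 n) (pi2 n).
  by have := ns _ _ maxn; rewrite wX eqxx.
by move=> t; rewrite leqNgt; apply/negP => it; apply: none; exists t.
Qed.

(** * Genericity and the failure of domination *)

Definition divergent (c : nat) : set (seq bool) :=
  [set s | exists n, forall t, ~~ (prefix s t && halts t c n)].

(** The component m+1 makes every argument [npair e u] of the request exceed m. *)
Definition request c m t0 := npair c (npair t0 m.+1).

(** By [str_code_lt], 2^(e+3) rounds cover the codes of all strings of length e+2, hence the round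
    selected by any X. *)
Definition completed (c m : nat) : set (seq bool) :=
  [set s | exists t0 t, (2 ^ (request c m t0).+3 <= idx (request c m t0) t) &&
                        prefix (tip (request c m t0) t) s].

Lemma computable_rel3I (P : nat -> nat -> seq bool -> bool) :
  computable (fun z => nat_of_bool (P (pi1 z) (pi1 (pi2 z)) (dec (pi2 (pi2 z))))) ->
  computable_rel3 P.
Proof. by move=> cP; eexists; first exact: cP; move=> x y s /=; rewrite !npairE str_codeK. Qed.

Lemma Sigma02_divergent c : Sigma02 (divergent c).
Proof.
exists (fun n y s => ~~ (prefix s (dec y) && halts (dec y) c n)).
  apply: computable_rel3I; rewrite /computable /halts; tle; last by apply: turing_le_run; tle.
  by apply: turing_le_prefix; tle.
move=> s; split=> -[n h]; exists n => t; first exact: h.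
by have := h (str_code t); rewrite str_codeK.
Qed.

Lemma Sigma02_completed c m : Sigma02 (completed c m).
Proof.
exists (fun x _ s => (2 ^ (request c m (pi1 x)).+3 <= idx (request c m (pi1 x)) (pi2 x)) &&
                        prefix (tip (request c m (pi1 x)) (pi2 x)) s).
  apply: computable_rel3I; rewrite /computable /request; tle.
    by apply: turing_le_idx; tle.
  by rewrite /tip; apply: turing_le_prefix; tle; apply: turing_le_proc; tle.
move=> s; split=> [[t0 [t h]]|[x h]].
  by exists (npair t0 t) => _; rewrite !npairE.
by exists (pi1 x), (pi2 x); exact: h 0.
Qed.

Lemma prefix_initseg X s l : prefix s (initseg X l) -> s = initseg X (size s).
Proof.
move=> ps; have sl : size s <= l.
  by case/prefixP: ps => u /(congr1 size); rewrite size_mkseq size_cat => ->; exact: leq_addr.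
by move: ps (initseg_prefix X _ _ sl); rewrite !prefixE size_mkseq => /eqP -> /eqP.
Qed.

Lemma generic_meets_completed G p f m : two_generic G ->
  (forall n, Defs.eval G p n (f n)) -> Defs.meets G (completed (code p) m).
Proof.
move=> genG pf.
(* A divergent initial segment of G is impossible: the program halts at n on a longer one. *)
have [[l [n h]]|[l0 conv]] := genG _ (Sigma02_divergent (code p)).
  have [L /(_ (maxn L l) (leq_maxl _ _))[hG _]] := run_complete _ _ _ _ (pf n).
  by have := h (initseg G (maxn L l)); rewrite hG initseg_prefix ?leq_maxr.
have [//|[l1 none]] := genG _ (Sigma02_completed (code p) m).
(* Starting beyond both l0 and l1 keeps every tip outside [divergent] and outside [completed]. *)
pose e := request (code p) m (str_code (initseg G (maxn l0 l1))).
have tip0 : tip e 0 = initseg G (maxn l0 l1) by rewrite /tip /= !npairE str_codeK.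
have [t ht] : exists t, 2 ^ e.+3 <= idx e t.
  (* A tip without a halting extension would witness divergence at the argument [npair e u]. *)
  apply: proc_unbounded => t u; apply: contrapT => noext.
  apply: (conv (tip e t)).
    apply: prefix_trans (tip_prefix e t).
    by rewrite tip0 initseg_prefix ?leq_maxl.
  exists (npair e u) => rho; apply/negP => /andP[p1 p2]; apply: noext.
  by exists rho => //; rewrite /e /request npairE.
case: (none (tip e t)).
  apply: prefix_trans (tip_prefix e t).
  by rewrite tip0 initseg_prefix ?leq_maxr.
by exists (str_code (initseg G (maxn l0 l1))), t; rewrite -/e ht prefix_refl.
Qed.

Lemma escape_not_dominated G X H f : two_generic G -> turing_le f G ->
  ~ dominates f (escape X H).
Proof.
move=> genG [p pf] [m dom].
have [l [t0 [t /andP[it ptip]]]] := generic_meets_completed _ _ _ m genG pf.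
set e := request _ _ _ in it ptip.
have [_ _ rounds] := proc_rounds e t.
(* The round selected by X. Its final string lies along G, so the value copied there is the value of
   f, against strict domination. *)
have [|u [v [[iu su iv] ivS hv pv]]] := rounds (str_code (initseg X e.+2)).
  apply: leq_trans it; have := str_code_lt (initseg X e.+2).
  by rewrite size_mkseq; lia.
have wX : waits X (npair e u) by rewrite /waits !npairE su iu !eqxx.
have mn : m < npair e u.
  have := leq_npair e u; rewrite /e /request.
  have := leq_npair (code p) (npair t0 m.+1); have := leq_npair t0 m.+1; lia.
have := dom _ mn; rewrite (escape_round X H e u v wX) ?iu //.
have vG := prefix_initseg _ _ _ (prefix_trans pv ptip).
have codee : pi1 e = code p by rewrite /e /request npairE.
rewrite vG codee (run_sound _ _ _ _ _ (pf (npair e u))) ?ltnn //.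
by rewrite -vG -codee.
Qed.

(** * Measure of the sequences to avoid *)

Section positive_measure.
Context {R : realType}.
Import Order.TTheory GRing.Theory Num.Theory.
Local Open Scope ring_scope.
Local Open Scope classical_set_scope.

(** The cylinders have total measure at most the sum of 2^-(e+2), that is 1/2, and the null set adds
    nothing. *)
Lemma avoid_cylinders (N : set cantor) (s : nat -> seq bool) :
  (fair_coin R).-negligible N -> (forall e, size (s e) = e.+2) ->
  exists X, ~ N X /\ forall e, ~ cylinder (s e) X.
Proof.
move=> [A [mA A0 NA]] sz; apply: contrapT => none.
have mcyl t : measurable (cylinder t : set cantor).
  by apply: sub_sigma_algebra; exists t.
(* Absorbing the null set into each cylinder keeps the cover indexed by e without changing the
   measures. *)
pose F e : set cantor := cylinder (s e) `|` A.
have mF e : measurable (F e) by exact: measurableU.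
have cover : [set: cantor] `<=` \bigcup_e F e.
  move=> X _; apply: contrapT => nF; apply: none; exists X; split.
    by move=> /NA AX; apply: nF; exists 0%N => //; right.
  by move=> e cX; apply: nF; exists e => //; left.
have := measure_sigma_subadditive (fair_coin R) mF measurableT cover.
rewrite [X in (X <= _)%E](_ : _ = 1%E); last exact: probability_setT.
(* 2^-(e+2) is written as (1/2)/2^(e+1) to fit [epsilon_trick0]. *)
rewrite (eq_eseriesr (g := fun e => ((1 / 2) / (2 ^ e.+1)%:R)%:E)); last first.
  move=> e _; transitivity (fair_coin R (cylinder (s e))); first exact: measureU0.
  rewrite fair_coin_cylinder sz; congr EFin.
  by rewrite exprS invfM natrX div1r.
by move=> /le_trans /(_ (epsilon_trick0 xpredT _)); rewrite lee_fin => /(_ ltac:(lra)); lra.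
Qed.

End positive_measure.

Theorem theorem4p13 (R : realType) (G : nat -> bool) :
  two_generic G -> ~ ae_dominating R G.
Proof.
move=> genG aeG.
have [s sP] := choice stuck_string.
have [X [domX cylX]] := avoid_cylinders _ s aeG (fun e => proj1 (sP e)).
have H : forall n, exists v, served X n v.
  apply: not_stuck_served => e u maxu; apply/negP => /eqP Xu.
  exact: (cylX e) (proj2 (sP e) X u maxu Xu).
(* [domX] says that X is not in the complement of the set where domination holds, hence
   [contrapT]. *)
have [f fG dom] := contrapT domX _ (turing_le_escape X H).
exact: escape_not_dominated genG fG dom.
Qed.
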